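(* Let $n\in\omega$, let $T={}^{\leq n}2$ be the set of all sequences of length at most $n$ with entries in $\{0,1\}$ (including the empty sequence), ordered by extension, and let $\langle T,\bar\mu\rangle$ be a probability tree, i.e. $\bar\mu=\langle\mu_t : t\in T,\ |t|<n\rangle$ where each $\mu_t$ is a probability measure on the power set of $\{t^\frown\langle 0\rangle,\ t^\frown\langle 1\rangle\}$. Equip the set ${}^n2$ of sequences of length $n$ with the probability measure given by $$\Pr[\{t\}]=\prod_{k<n}\mu_{t\upharpoonright k}\big(\{t\upharpoonright(k+1)\}\big)\qquad (t\in{}^n2),$$ and let $Y\colon {}^n2\to\mathbb R$ be the random variable $Y(t)=|\{k<n : t(k)=0\}|$ (the number of successes after $n$ trials, success being coded by $0$). Assume that $p\in[0,1]$ satisfies $p\le \mu_t(\{t^\frown\langle 0\rangle\})$ for every $t\in T$ with $|t|<n$. Then, for all $z\in\mathbb R$, $$\Pr[Y\le z]\le \Pr[\mathrm B_{n,p}\le z],$$ where $\mathrm B_{n,p}$ denotes a random variable with the binomial distribution with $n$ trials and success probability $p$.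
   Context: For a sequence $t$, $|t|$ is its length, $t\upharpoonright k$ is its initial segment of length $k$, $t(k)$ is its $k$-th entry (indexing starts at $0$), and $t^\frown\langle i\rangle$ is $t$ extended by the single entry $i$. The probability tree models $n$ dependent, not necessarily identically distributed, Bernoulli trials: $\mu_t(\{t^\frown\langle0\rangle\})$ is the probability of success of trial number $|t|$ given the outcomes $t$ of the previous trials. *)

(* Defs.v *)
From HB Require Import structures.
From mathcomp Require Import all_boot all_order all_algebra.
From mathcomp Require Import all_classical all_reals all_analysis.

Set Implicit Arguments.
Unset Strict Implicit.
Unset Printing Implicit Defensive.

Import Order.TTheory GRing.Theory Num.Theory.

Local Open Scope classical_set_scope.
Local Open Scope ring_scope.

Definition children (t : seq 'I_2) :=
  {u : seq 'I_2 | u \in [:: rcons t 0; rcons t 1]}.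

Definition child0 t : children t :=
  exist _ (rcons t 0) (mem_head (rcons t 0) [:: rcons t 1]).

HB.instance Definition _ t := Choice.on (children t).
HB.instance Definition _ t := isPointed.Build (children t) (child0 t).
HB.instance Definition _ t := @isMeasurable.Build default_measure_display
  (children t) discrete_measurable discrete_measurable0
  discrete_measurableC discrete_measurableU.

(* The tree is the set of sequences of length at most n; its leaves carry no
   measure. *)
Definition prob_tree (R : realType) (n : nat) :=
  forall t : seq 'I_2, (size t < n)%N -> probability (children t) R.

(* The alias shields this type from the product sigma-algebra that the library
   puts on tuples: every set of leaves is measurable. *)
Definition leaves (n : nat) := n.-tuple 'I_2.

HB.instance Definition _ n := Finite.on (leaves n).
HB.instance Definition _ n := isPointed.Build (leaves n) [tuple 0 | i < n].
HB.instance Definition _ n := @isMeasurable.Build default_measure_display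
  (leaves n) discrete_measurable discrete_measurable0
  discrete_measurableC discrete_measurableU.

Lemma size_take_leaf n (t : leaves n) (k : 'I_n) : (size (take k t) < n)%N.
Proof. by rewrite size_takel ?size_tuple ?ltn_ord // ltnW. Qed.

Section tree_measure.
Context (R : realType) (n : nat) (mu : prob_tree R n).

(* [set u | val u = take k.+1 t] is the singleton of the restriction of t to
   its first k + 1 entries, a subset of the children of take k t. *)
Definition leaf_prob (t : leaves n) : \bar R :=
  (\prod_(k < n)
     @mu (take k t) (size_take_leaf t k) [set u | val u = take k.+1 t])%E.

Definition tree_prob (A : set (leaves n)) : \bar R :=
  (\sum_(t \in A) leaf_prob t)%E.

Let leaf_prob_ge0 t : (0 <= leaf_prob t)%E.
Proof. by apply: prode_ge0 => k _; exact: measure_ge0. Qed.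

Let tree_prob0 : tree_prob set0 = 0%E.
Proof. by rewrite /tree_prob fsbig_set0. Qed.

Let tree_prob_ge0 A : (0 <= tree_prob A)%E.
Proof. by rewrite /tree_prob; apply: fsume_ge0 => t _; exact: leaf_prob_ge0. Qed.

Let tree_probE A : tree_prob A = (\esum_(t in A) leaf_prob t)%E.
Proof. by rewrite esum_fset//; exact: finite_finset. Qed.

Let tree_prob_sigma_additive : semi_sigma_additive tree_prob.
Proof.
move=> F mF tF mUF; apply: cvg_toP.
  apply: ereal_nondecreasing_is_cvgn => a b ab.
  by apply: lee_sum_nneg_natr => // k _ _; exact: tree_prob_ge0.
rewrite tree_probE nneseries_sum_bigcup//.
by apply: eq_eseriesr => k _; exact: tree_probE.
Qed.

HB.instance Definition _ := isMeasure.Build _ _ _ tree_prob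
  tree_prob0 tree_prob_ge0 tree_prob_sigma_additive.

Let step (s : seq 'I_2) (i : 'I_2) : R :=
  if (size s < n)%N =P true is ReflectT h
  then fine (@mu s h [set u | val u = rcons s i]) else 0.

Let stepE s h i : (@mu s h [set u | val u = rcons s i] = (step s i)%:E)%E.
Proof.
rewrite /step; case: eqP => // h'.
by rewrite fineK ?(bool_irrelevance h h') ?fin_num_measure.
Qed.

Let step1 s : (size s < n)%N -> step s 0 + step s 1 = 1.
Proof.
move=> h; apply: EFin_inj; rewrite EFinD -!(stepE h) -measureU//; last first.
  by apply/seteqP; split=> // u [/= ->] /(congr1 (last 0)); rewrite !last_rcons.
rewrite -(probability_setT (mu h)); congr (mu h _).
apply/seteqP; split=> // u _ /=.
by case: u => u /=; rewrite !inE => /orP[]/eqP ->; [left|right].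
Qed.

Let leaf_probE t :
  leaf_prob t = (\prod_(k < n) step (take k t) (tnth t k))%:E.
Proof.
rewrite -prodEFin; apply: eq_bigr => k _.
by rewrite (take_nth (tnth t k)) ?size_tuple// -tnth_nth stepE.
Qed.

Let sum_prod_step m (f : seq 'I_2 -> 'I_2 -> R) :
    (forall s, (size s < m)%N -> f s 0 + f s 1 = 1) ->
  \sum_(t : m.-tuple 'I_2) \prod_(k < m) f (take k t) (tnth t k) = 1.
Proof.
elim: m f => [|m IHm] f f1.
  by rewrite (big_pred1 [tuple]) ?big_ord0// => t; apply/esym/eqP/tuple0.
rewrite (reindex (fun p : 'I_2 * m.-tuple 'I_2 => [tuple of p.1 :: p.2]))/=;
  last first.
  exists (fun t => (thead t, [tuple of behead t])) => [[i t]|t] _ /=.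
    by congr pair; apply: val_inj.
  by rewrite [RHS]tuple_eta.
rewrite -(pair_bigA _ (fun (i : 'I_2) (t : m.-tuple 'I_2) =>
   \prod_(k < m.+1) f (take k (i :: t)) (tnth [tuple of i :: t] k)))/=.
rewrite -[RHS](f1 [::] isT).
transitivity (\sum_(i : 'I_2) f [::] i); last first.
  by rewrite !big_ord_recl big_ord0 addr0; congr (_ + f _ _); apply: val_inj.
apply: eq_bigr => i _.
rewrite -[RHS]mulr1 -[in RHS](IHm (fun s => f (i :: s))); last first.
  by move=> s sm; exact: f1.
rewrite mulr_sumr; apply: eq_bigr => t _.
rewrite big_ord_recl /= tnth0; congr (_ * _).
by apply: eq_bigr => k _; rewrite tnthS.
Qed.

Lemma tree_probT : tree_prob setT = 1%E.
Proof.
have -> : [set: leaves n] = [set` index_enum (leaves n)].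
  by apply/seteqP; split=> // t _ /=; rewrite mem_index_enum.
rewrite /tree_prob -fsbig_seq ?index_enum_uniq//.
under eq_bigr do rewrite leaf_probE.
by rewrite sumEFin (sum_prod_step step1).
Qed.

HB.instance Definition _ :=
  Measure_isProbability.Build _ _ _ tree_prob tree_probT.

Lemma tree_prob1 t : tree_prob [set t] = leaf_prob t.
Proof. by rewrite /tree_prob fsbig_set1. Qed.

End tree_measure.

(* Success is coded by the entry 0, not 1. *)
Definition successes (R : realType) n (t : leaves n) : R :=
  #|[pred k : 'I_n | tnth t k == 0]|%:R.

HB.instance Definition _ R n :=
  isMeasurableFun.Build _ _ _ _ (@successes R n) (fun _ _ _ => I).

(* Main.v *)
Require Import Defs.
From mathcomp Require Import all_boot all_order all_algebra.
From mathcomp Require Import all_classical all_reals all_analysis.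
From mathcomp Require Import lra.

(* Induction on the number of trials, proving more generally that the expected
   value of a nonincreasing function g of the number of successes is at most its
   binomial counterpart.  Conditioning on the first trial, of success
   probability q >= p, reduces this to
   q B(g o S) + (1 - q) B(g) <= p B(g o S) + (1 - p) B(g), where B is the
   expectation for one trial less; it holds because B(g o S) <= B(g). *)

Import Order.TTheory GRing.Theory Num.Theory.

Local Open Scope classical_set_scope.
Local Open Scope ring_scope.

Definition binomial_expect {R : realType} (m : nat) (p : R)
    (g : nat -> R) : R :=
  \sum_(k < m.+1) binomial_pmf m p k * g k.

Lemma binomial_pmf_eq0 (R : realType) (m k : nat) (p : R) :
  (m < k)%N -> binomial_pmf m p k = 0.
Proof. by move=> mk; rewrite /binomial_pmf bin_small. Qed.

Lemma binomial_pmfS0 (R : realType) (m : nat) (p : R) :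
  binomial_pmf m.+1 p 0 = (1 - p) * binomial_pmf m p 0.
Proof.
by rewrite /binomial_pmf !bin0 !subn0 !mulr1n !expr0 !mul1r exprS.
Qed.

(** Pascal's rule [binS]: each of its two binomial coefficients gives one outcome of the extra
    trial. *)
Lemma binomial_pmfSS (R : realType) (m k : nat) (p : R) :
  binomial_pmf m.+1 p k.+1 =
    p * binomial_pmf m p k + (1 - p) * binomial_pmf m p k.+1.
Proof.
rewrite /binomial_pmf binS subSS mulrnDr addrC; congr (_ + _).
  by rewrite exprS -mulrA mulrnAr.
(* The subtraction in the exponent [m - k.+1] truncates when [m <= k], but the coefficient
   ['C(m, k.+1)] is then 0. *)
have [km|mk] := ltnP k m; last by rewrite bin_small// !mulr0n mulr0.
by rewrite -(subnSK km) (exprS _ (m - k.+1)) mulrCA mulrnAr.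
Qed.

Lemma binomial_expectS (R : realType) (m : nat) (p : R) (g : nat -> R) :
  binomial_expect m.+1 p g =
    p * binomial_expect m p (g \o S) + (1 - p) * binomial_expect m p g.
Proof.
have -> : binomial_expect m p g = binomial_pmf m p 0 * g 0%N +
    \sum_(k < m.+1) binomial_pmf m p k.+1 * g k.+1.
  (* Adding the zero term at [k = m.+1] leaves [m.+1] terms after index 0 is split off, which
     matches the range of the sum for [g \o S]. *)
  transitivity (\sum_(k < m.+2) binomial_pmf m p k * g k).
    by rewrite big_ord_recr/= binomial_pmf_eq0// mul0r addr0.
  by rewrite big_ord_recl.
rewrite /binomial_expect big_ord_recl/= binomial_pmfS0 mulrDr addrCA -mulrA.
congr (_ + _); rewrite !mulr_sumr.
rewrite -big_split/=; apply: eq_bigr => k _.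
by rewrite binomial_pmfSS mulrDl !mulrA.
Qed.

Lemma ler_binomial_expect (R : realType) (m : nat) (p : R) (g h : nat -> R) :
    0 <= p <= 1 -> (forall k, g k <= h k) ->
  binomial_expect m p g <= binomial_expect m p h.
Proof.
by move=> p01 gh; apply: ler_sum => k _; rewrite ler_wpM2l ?binomial_pmf_ge0.
Qed.

(** Conditioning on the first entry [i]: the subtree above it is again a tree, with weights
    [f (i :: _)]. *)
Lemma tree_expectS (R : realType) (m : nat) (f : seq 'I_2 -> 'I_2 -> R)
    (g : nat -> R) :
  \sum_(t : m.+1.-tuple 'I_2)
      (\prod_(k < m.+1) f (take k t) (tnth t k)) * g (count_mem 0 t) =
  \sum_(i : 'I_2) f [::] i * \sum_(t : m.-tuple 'I_2)
      (\prod_(k < m) f (i :: take k t) (tnth t k)) *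
        g ((i == 0%R) + count_mem 0%R t)%N.
Proof.
rewrite (reindex (fun u : 'I_2 * m.-tuple 'I_2 => [tuple of u.1 :: u.2]))/=;
  last first.
  exists (fun t => (thead t, [tuple of behead t])) => [[i t]|t] _ /=.
    by congr pair; apply: val_inj.
  by rewrite [RHS]tuple_eta.
rewrite -(pair_bigA _ (fun (i : 'I_2) (t : m.-tuple 'I_2) =>
   (\prod_(k < m.+1) f (take k (i :: t)) (tnth [tuple of i :: t] k)) *
     g ((i == 0%R) + count_mem 0%R t)%N))/=.
apply: eq_bigr => i _; rewrite mulr_sumr; apply: eq_bigr => t _.
rewrite big_ord_recl /= tnth0 -mulrA; congr (_ * (_ * _)).
by apply: eq_bigr => k _; rewrite tnthS.
Qed.

(** Both [f] and [g] vary in the induction, since a subtree changes the weights and a first success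
    replaces [g] by [g \o S]. Nonnegativity of [f s 0] follows from [0 <= p <= f s 0]. *)
Lemma tree_expect_le_binomial (R : realType) (m : nat) (p : R)
    (f : seq 'I_2 -> 'I_2 -> R) (g : nat -> R) :
    0 <= p <= 1 ->
    (forall s, (size s < m)%N -> f s 0 + f s 1 = 1) ->
    (forall s, (size s < m)%N -> p <= f s 0) ->
    (forall s, (size s < m)%N -> 0 <= f s 1) ->
    (forall k, g k.+1 <= g k) ->
  \sum_(t : m.-tuple 'I_2)
      (\prod_(k < m) f (take k t) (tnth t k)) * g (count_mem 0 t) <=
  binomial_expect m p g.
Proof.
move=> p01; elim: m f g => [|m IHm] f g f1 fp f0 gS.
  rewrite (big_pred1 [tuple]); last by move=> t; apply/esym/eqP/tuple0.
  rewrite /binomial_expect big_ord_recl !big_ord0 addr0/= /binomial_pmf.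
  by rewrite bin0 subn0 !expr0 mulr1.
rewrite tree_expectS binomial_expectS big_ord_recl big_ord1.
have -> : lift ord0 ord0 = 1 :> 'I_2 by exact: val_inj.
have IH0 := IHm (fun s => f (0 :: s)) (g \o S) (fun s => f1 (0 :: s))
  (fun s => fp (0 :: s)) (fun s => f0 (0 :: s)) (fun k => gS k.+1).
have IH1 := IHm (fun s => f (1 :: s)) g (fun s => f1 (1 :: s))
  (fun s => fp (1 :: s)) (fun s => f0 (1 :: s)) gS.
have Bg : binomial_expect m p (g \o S) <= binomial_expect m p g.
  exact: ler_binomial_expect.
have f0p := fp [::] isT.
have f00 : 0 <= f [::] 0 by case/andP : p01 => p0 _; exact: le_trans f0p.
apply: le_trans (lerD (ler_wpM2l f00 IH0) (ler_wpM2l (f0 [::] isT) IH1)) _.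
have -> : f [::] 1 = 1 - f [::] 0 by rewrite -(f1 [::] isT) addrAC subrr add0r.
(* The right side minus the left is the product of [f [::] 0 - p] and [binomial_expect m p g -
   binomial_expect m p (g \o S)], both nonnegative. *)
nra.
Qed.

(* The junk value 0 at nodes of length at least n lets the induction above run
   on a function of all sequences, free of length proofs. *)
Definition tree_step {R : realType} {n : nat} (mu : prob_tree R n)
    (s : seq 'I_2) (i : 'I_2) : R :=
  if (size s < n)%N =P true is ReflectT h
  then fine (mu s h [set u | val u = rcons s i]) else 0.

Lemma tree_stepE (R : realType) (n : nat) (mu : prob_tree R n)
    (s : seq 'I_2) (h : (size s < n)%N) (i : 'I_2) :
  mu s h [set u | val u = rcons s i] = (tree_step mu s i)%:E.
Proof.
rewrite /tree_step; case: eqP => // h'.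
by rewrite fineK ?(bool_irrelevance h h') ?fin_num_measure.
Qed.

Lemma tree_step_ge0 (R : realType) (n : nat) (mu : prob_tree R n)
    (s : seq 'I_2) (i : 'I_2) : 0 <= tree_step mu s i.
Proof. by rewrite /tree_step; case: eqP => // h; rewrite fine_ge0. Qed.

(** The two singletons partition [children s]; they are disjoint because the last entries differ. *)
Lemma tree_step_sum1 (R : realType) (n : nat) (mu : prob_tree R n)
    (s : seq 'I_2) :
  (size s < n)%N -> tree_step mu s 0 + tree_step mu s 1 = 1.
Proof.
move=> h; apply: EFin_inj; rewrite EFinD -!(tree_stepE _ _ _ _ h).
rewrite -measureU//; last first.
  by apply/seteqP; split=> // u [/= ->] /(congr1 (last 0)); rewrite !last_rcons.
rewrite -(probability_setT (mu s h)); congr (mu s h _).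
apply/seteqP; split=> // u _ /=.
by case: u => u /=; rewrite !inE => /orP[]/eqP ->; [left|right].
Qed.

Lemma leaf_prob_tree_step (R : realType) (n : nat) (mu : prob_tree R n)
    (t : leaves n) :
  leaf_prob mu t = (\prod_(k < n) tree_step mu (take k t) (tnth t k))%:E.
Proof.
rewrite -prodEFin; apply: eq_bigr => k _.
by rewrite (take_nth (tnth t k)) ?size_tuple// -tnth_nth tree_stepE.
Qed.

(** Writes an event's probability as the expectation of its indicator, the form that
    [tree_expect_le_binomial] bounds. *)
Lemma tree_prob_sum (R : realType) (n : nat) (mu : prob_tree R n)
    (A : set (leaves n)) :
  tree_prob mu A = (\sum_(t : leaves n)
    (\prod_(k < n) tree_step mu (take k t) (tnth t k)) * (t \in A)%:R)%:E.
Proof.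
rewrite /tree_prob fsbig_mkcond.
have -> : [set: leaves n] = [set` index_enum (leaves n)].
  by apply/seteqP; split=> // t _ /=; rewrite mem_index_enum.
rewrite -fsbig_seq ?index_enum_uniq// -sumEFin; apply: eq_bigr => t _.
rewrite /patch leaf_prob_tree_step.
by case: (t \in A); rewrite ?mulr1 ?mulr0.
Qed.

Lemma binomial_prob_expect (R : realType) (m : nat) (p : R) (U : set nat) :
    0 <= p <= 1 ->
  binomial_prob m p U =
    (binomial_expect m p (fun k => (k \in U)%:R))%:E.
Proof.
move=> /andP[p0 p1]; rewrite (@binomial_probE _ m p p0 p1) -sumEFin.
by apply: eq_bigr => k _; rewrite diracE EFinM.
Qed.

Lemma successes_count (R : realType) (n : nat) (t : leaves n) :
  successes R t = (count_mem 0 (val t))%:R.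
Proof. by rewrite /successes -sum1_card -sum1_count big_tuple. Qed.

Theorem theoremA (R : realType) (n : nat) (mu : prob_tree R n) (p : R)
    (p01 : 0 <= p <= 1)
    (hp : forall (t : seq 'I_2) (ht : (size t < n)%N),
      (p%:E <= mu t ht [set u : children t | val u = rcons t 0%R])%E)
    (z : R) :
  (tree_prob mu [set t | (successes R t <= z)%R]
     <= binomial_prob n p [set k : nat | (k%:R <= z)%R])%E.
Proof.
rewrite tree_prob_sum binomial_prob_expect// lee_fin.
have step_ge s : (size s < n)%N -> p <= tree_step mu s 0.
  by move=> h; rewrite -lee_fin -tree_stepE.
(* The function [g] is the indicator of a downward closed set of counts. *)
have g_noninc k : ((k.+1 \in [set k : nat | (k%:R <= z)%R])%:R : R) <=
    (k \in [set k : nat | (k%:R <= z)%R])%:R.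
  rewrite ler_nat; case: (boolP (k.+1 \in _)) => // /set_mem/= kz.
  by rewrite mem_set//=; apply: le_trans kz; rewrite ler_nat.
apply: le_trans (tree_expect_le_binomial R n p (tree_step mu) _ p01
  (tree_step_sum1 R n mu) step_ge (fun s _ => tree_step_ge0 R n mu s 1) g_noninc).
(* What remains is an equality: the two indicators agree at each leaf, as [successes] counts the
   zeros. *)
rewrite le_eqVlt; apply/orP; left; apply/eqP; apply: eq_bigr => t _.
congr (_ * _%:R); congr nat_of_bool.
by apply/idP/idP => /set_mem tz; apply/mem_set; move: tz;
  rewrite /= successes_count.
Qed.
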